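(* Let $G$ be a group, $k$ a field, $\omega:G\times G\times G\to k$ an invertible normalized $3$-cocycle, and $H=kG$ the corresponding coquasi-Hopf algebra. Let $A=\bigoplus_{g\in G}A_g$ be a right $H$-comodule algebra, i.e. a $G$-graded vector space with a unit and a multiplication such that $A_gA_h\subseteq A_{gh}$ for all $g,h\in G$ and $(ab)c=a(bc)\,\omega(|a|,|b|,|c|)$ for all homogeneous $a,b,c\in A$. Then the extension $A_e\subseteq A$ is Galois if and only if $A$ is strongly graded.
   Context: $\otimes=\otimes_k$; $e$ is the neutral element of $G$ and $|a|$ is the degree of a homogeneous element $a$. ''Invertible normalized $3$-cocycle'' means that the values of $\omega$ are nonzero, $\omega(h,g,xy)\,\omega(hg,x,y)=\omega(g,x,y)\,\omega(h,gx,y)\,\omega(h,g,x)$ and $\omega(h,e,g)=1$ for all $h,g,x,y\in G$. The group algebra $kG$ (usual multiplication, comultiplication $\Delta(g)=g\otimes g$, counit and antipode $S(g)=g^{-1}$) is a coquasi-Hopf algebra with reassociator the linear extension of $\omega$, with $\alpha=\varepsilon$ and $\beta(g)=\omega^{-1}(g,g^{-1},g)$ for $g\in G$, where $\omega^{-1}$ is the pointwise inverse. A $kG$-coaction is a $G$-grading ($\rho(a)=a\otimes|a|$), and the unit $1_A$ lies in $A_e$ and is two-sided. The coinvariants of $A$ are $A_e$, an associative algebra, and $A$ is an $A_e$-bimodule by multiplication. The extension $A_e\subseteq A$ is Galois if the map $can:A\otimes_{A_e}A\to A\otimes kG$ given on homogeneous elements by $can(a\otimes b)=ab\otimes|b|\;\omega^{-1}(|a|,|b|,|b|^{-1})\,\beta(|b|)$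 is bijective. (This is the specialization of the general Galois map $a\otimes_Bb\mapsto a_0b_0\otimes b_4\,\omega^{-1}(a_1,b_1\beta(b_2),S(b_3))$ for coquasi-Hopf algebras, in Sweedler notation.) $A$ is strongly graded if $A_gA_h=A_{gh}$ for all $g,h\in G$, where $A_gA_h$ is the span of the products. *)

(* Defs.v *)
From HB Require Import structures.
From mathcomp Require Import all_boot all_order all_algebra generic_quotient.
From mathcomp Require Import finmap monalg.
From mathcomp Require Import boolp classical_sets.

Set Implicit Arguments.
Unset Strict Implicit.
Unset Printing Implicit Defensive.

Import GRing.Theory.
Local Open Scope ring_scope.
Local Open Scope quotient_scope.

Section LinearSpan.
Variables (R : pzRingType) (V : lmodType R) (S : set V).

Definition linspan : {pred V} := fun v =>
  `[< exists s : seq (R * V),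
        (forall p, p \in s -> S p.2) /\ v = \sum_(p <- s) p.1 *: p.2 >].

Lemma linspan_gen v : S v -> v \in linspan.
Proof.
move=> Sv; apply/asboolP; exists [:: (1, v)]; split=> [p|].
  by rewrite inE => /eqP->.
by rewrite big_seq1 scale1r.
Qed.

Lemma linspan_submod_closed : submod_closed linspan.
Proof.
split=> [|a u v /asboolP[s [sS ->]] /asboolP[t [tS ->]]]; apply/asboolP.
  by exists [::]; rewrite big_nil.
exists ([seq (a * p.1, p.2) | p <- s] ++ t); split=> [p|].
  by rewrite mem_cat => /orP[/mapP[q qs ->]|/tS//]; exact: (sS q).
rewrite big_cat big_map scaler_sumr; congr (_ + _).
by apply: eq_bigr => p _; rewrite scalerA.
Qed.

HB.instance Definition _ :=
  GRing.isSubmodClosed.Build R V linspan linspan_submod_closed.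

Lemma linspan_min (D : {pred V}) : submod_closed D ->
  (forall v, S v -> v \in D) -> {subset linspan <= D}.
Proof.
move=> [D0 DL] SD _ /asboolP[s [sS ->]].
elim: s sS => [|p s IHs] sS; first by rewrite big_nil.
rewrite big_cons DL//; first by apply/SD/sS; rewrite mem_head.
by apply: IHs => q qs; apply: sS; rewrite inE qs orbT.
Qed.

End LinearSpan.

Section QuotientModule.
Variables (R : pzRingType) (V : lmodType R) (S : set V).

Definition quotmod := Quotient.quot (linspan S).

HB.instance Definition _ := GRing.Zmodule.on quotmod.
HB.instance Definition _ := ZmodQuotient.on quotmod.

Definition quotproj (v : V) : quotmod := \pi_quotmod v.

Lemma quotprojP u v : reflect (quotproj u = quotproj v) (u - v \in linspan S).
Proof. by rewrite Quotient.idealrBE; apply: (iffP eqP). Qed.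

Lemma quotprojK (x : quotmod) : quotproj (repr x) = x.
Proof. exact: reprK. Qed.

Lemma quotprojD : {morph quotproj : u v / u + v}.
Proof. by move=> u v; rewrite /quotproj !piE. Qed.

Definition quotscale (a : R) (x : quotmod) : quotmod := quotproj (a *: repr x).

Lemma quotscaleE a v : quotscale a (quotproj v) = quotproj (a *: v).
Proof.
apply/quotprojP; rewrite -scalerBr rpredZ//.
by apply/quotprojP; rewrite quotprojK.
Qed.

Lemma quotscaleA a b x : quotscale a (quotscale b x) = quotscale (a * b) x.
Proof. by rewrite -[x]quotprojK !quotscaleE scalerA. Qed.

Lemma quotscale1 : left_id 1 quotscale.
Proof. by move=> x; rewrite -[x]quotprojK quotscaleE scale1r. Qed.

Lemma quotscaleDr : right_distributive quotscale +%R.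
Proof.
move=> a x y; rewrite -[x]quotprojK -[y]quotprojK.
by rewrite -quotprojD !quotscaleE scalerDr quotprojD.
Qed.

Lemma quotscaleDl x : {morph quotscale^~ x : a b / a + b}.
Proof.
by move=> a b; rewrite -[x]quotprojK !quotscaleE scalerDl quotprojD.
Qed.

HB.instance Definition _ := GRing.Zmodule_isLmodule.Build R quotmod
  quotscaleA quotscale1 quotscaleDr quotscaleDl.

Lemma quotproj_linear : linear quotproj.
Proof. by move=> a u v; rewrite quotprojD -quotscaleE. Qed.

HB.instance Definition _ :=
  GRing.isLinear.Build R V quotmod *:%R quotproj quotproj_linear.

End QuotientModule.

(* [ra] and [la] are a right and a left action of the scalars [B]: the tensor *)
(* product over B is the free vector space on M x N modulo the relations      *)
(* making (m, n) |-> m (x) n bilinear over k and B-balanced.                  *)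
Section Tensor.
Variables (k : fieldType) (M N : lmodType k).
Variables (B : Type) (ra : M -> B -> M) (la : B -> N -> N).

Local Notation F := {malg k[(M * N)%type]}.

Inductive tensor_rel : F -> Prop :=
| TensorAddl m m' n :
    tensor_rel (<<(m + m', n)>> - (<<(m, n)>> + <<(m', n)>>))
| TensorAddr m n n' :
    tensor_rel (<<(m, n + n')>> - (<<(m, n)>> + <<(m, n')>>))
| TensorScalel c m n : tensor_rel (<<(c *: m, n)>> - c *: <<(m, n)>>)
| TensorScaler c m n : tensor_rel (<<(m, c *: n)>> - c *: <<(m, n)>>)
| TensorBal m b n : tensor_rel (<<(ra m b, n)>> - <<(m, la b n)>>).

Definition tensor := quotmod tensor_rel.
HB.instance Definition _ := GRing.Lmodule.on tensor.

Definition tens (m : M) (n : N) : tensor := quotproj tensor_rel <<(m, n)>>.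

Lemma tensDl m m' n : tens (m + m') n = tens m n + tens m' n.
Proof.
by rewrite -raddfD; apply/quotprojP/linspan_gen/TensorAddl.
Qed.

Lemma tensDr m n n' : tens m (n + n') = tens m n + tens m n'.
Proof.
by rewrite -raddfD; apply/quotprojP/linspan_gen/TensorAddr.
Qed.

Lemma tensZl c m n : tens (c *: m) n = c *: tens m n.
Proof.
by rewrite -linearZ; apply/quotprojP/linspan_gen/TensorScalel.
Qed.

Lemma tensZr c m n : tens m (c *: n) = c *: tens m n.
Proof.
by rewrite -linearZ; apply/quotprojP/linspan_gen/TensorScaler.
Qed.

Lemma tens_bal m b n : tens (ra m b) n = tens m (la b n).
Proof. exact/quotprojP/linspan_gen/TensorBal. Qed.

Variable W : lmodType k.

Definition balanced (f : M -> N -> W) : Prop :=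
  [/\ forall n, linear (f^~ n), forall m, linear (f m)
    & forall m b n, f (ra m b) n = f m (la b n)].

Definition freelift (f : M -> N -> W) (x : F) : W :=
  \sum_(p <- msupp x) x@_p *: f p.1 p.2.

(* The map induced by [f] on the tensor product, computed on a representative *)
(* and meaningful for balanced [f], see [tensor_liftE]. *)
Definition tensor_lift (f : M -> N -> W) (t : tensor) : W :=
  freelift f (repr t).

Lemma freeliftEw f (d : {fset (M * N)%type}) x : {subset msupp x <= d} ->
  freelift f x = \sum_(p <- d) x@_p *: f p.1 p.2.
Proof.
move=> sd; rewrite /freelift (big_fset_incl _ (B := d)) //; first exact/fsubsetP.
by move=> p _ /mcoeff_outdom->; rewrite scale0r.
Qed.

Lemma freelift_linear f : linear (freelift f).
Proof.
move=> a x y.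
pose d := (msupp x `|` msupp y `|` msupp (a *: x + y))%fset.
rewrite !(@freeliftEw f d); do ?by move=> p pd; rewrite !inE pd ?orbT.
rewrite scaler_sumr -big_split; apply: eq_bigr => p _ /=.
by rewrite mcoeffD mcoeffZ scalerDl scalerA.
Qed.

Lemma freeliftU f m n : freelift f <<(m, n)>> = f m n.
Proof.
rewrite (@freeliftEw f [fset (m, n)]%fset).
  by rewrite big_seq_fset1 mcoeffUU scale1r.
by move=> p; rewrite msuppU oner_eq0.
Qed.

HB.instance Definition _ f := GRing.isLinear.Build k F W *:%R (freelift f)
  (freelift_linear f).

Lemma tensor_lift_proj f : balanced f ->
  forall x : F, tensor_lift f (quotproj tensor_rel x) = freelift f x.
Proof.
move=> [fl fr fb] x; apply/eqP; rewrite -subr_eq0 -raddfB.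
have: repr (quotproj tensor_rel x) - x \in linspan tensor_rel.
  by apply/quotprojP; rewrite quotprojK.
apply: (@linspan_min _ _ _ [pred y | freelift f y == 0]) => [|y].
  split=> [|a u v]; rewrite !inE ?raddf0// => /eqP u0 /eqP v0.
  by rewrite linearP /= u0 v0 scaler0 addr0.
have fDl m m' n : f (m + m') n = f m n + f m' n.
  by have := fl n 1 m m'; rewrite !scale1r.
have fDr m n n' : f m (n + n') = f m n + f m n'.
  by have := fr m 1 n n'; rewrite !scale1r.
have f0l n : f 0 n = 0.
  by apply: (addrI (f 0 n)); rewrite -fDl !addr0.
have f0r m : f m 0 = 0.
  by apply: (addrI (f m 0)); rewrite -fDr !addr0.
case=> [m m' n|m n n'|c m n|c m n|m b n]; rewrite inE raddfB /= subr_eq0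
  ?[freelift f (_ + _)]raddfD ?[freelift f (_ *: _)]linearZ /= !freeliftU
  ?fDl ?fDr ?fb//.
- by have := fl n c m 0; rewrite f0l !addr0 => ->.
- by have := fr m c n 0; rewrite f0r !addr0 => ->.
Qed.

Lemma tensor_liftE f : balanced f ->
  linear (tensor_lift f) /\ forall m n, tensor_lift f (tens m n) = f m n.
Proof.
move=> fP; split=> [a t u|m n]; last by rewrite tensor_lift_proj// freeliftU.
rewrite -[t]quotprojK -[u]quotprojK -linearP !tensor_lift_proj//.
exact: linearP.
Qed.

End Tensor.

(* [{malg V[I]}] is the type of finitely supported families of vectors of V   *)
(* indexed by I. *)
Definition direct_decomposition (k : fieldType) (V : lmodType k)
    (I : choiceType) (S : I -> {pred V}) : Prop :=
  (forall i, submod_closed (S i)) /\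
  (forall v, exists! f : {malg V[I]},
     (forall i, f@_i \in S i) /\ v = \sum_(i <- msupp f) f@_i).

Record normalized_cocycle3 (k : fieldType) (G : groupType)
    (w : G -> G -> G -> k) : Prop := NormalizedCocycle3 {
  cocycle3_neq0 : forall g h x, w g h x != 0;
  cocycle3E : forall h g x y,
    w h g (x * y)%g * w (h * g)%g x y = w g x y * w h (g * x)%g y * w h g x;
  cocycle3_normal : forall h g, w h 1%g g = 1
}.

(* Right kG-comodule algebras, for the coquasi-Hopf algebra kG with           *)
(* reassociator w: the coaction is encoded as a G-grading.                    *)
Record comod_algebra (k : fieldType) (G : groupType) (w : G -> G -> G -> k) :=
  ComodAlgebra {
  carrier :> lmodType k;
  homog : G -> {pred carrier};
  homog_direct : direct_decomposition homog;
  amul : {bilinear carrier -> carrier -> carrier};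
  aone : carrier;
  amul_homog : forall g h a b,
    a \in homog g -> b \in homog h -> amul a b \in homog (g * h)%g;
  amulA : forall g h x a b c,
    a \in homog g -> b \in homog h -> c \in homog x ->
    amul (amul a b) c = w g h x *: amul a (amul b c);
  aone_homog : aone \in homog 1%g;
  amul1l : forall a, amul aone a = a;
  amul1r : forall a, amul a aone = a
}.

Arguments homog {k G w} _ _ : rename.
Arguments amul {k G w _}.

Section Galois.
Variables (k : fieldType) (G : groupType) (w : G -> G -> G -> k).
Variable A : comod_algebra w.

Definition coinv : Type := {b : A | b \in homog A 1%g}.

Definition coinv_tensor : lmodType k :=
  tensor (fun (a : A) (b : coinv) => amul a (sval b))
         (fun (b : coinv) (a : A) => amul (sval b) a).

Definition kG_tensor : lmodType k :=
  tensor (fun (a : A) (c : k) => c *: a)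
         (fun (c : k) (x : {malg k[G]}) => c *: x).

Definition ctens (a b : A) : coinv_tensor := tens _ _ a b.
Definition gtens (a : A) (x : {malg k[G]}) : kG_tensor := tens _ _ a x.

(* The family of the homogeneous components of [a]. *)
Definition hcomp (a : A) : {malg A[G]} := sval (cid ((homog_direct A).2 a)).

Definition kG_beta (g : G) : k := (w g (g^-1)%g g)^-1.

(* Bilinear extension, through homogeneous components, of the formula of     *)
(* [canE]. *)
Definition can_bil (a b : A) : kG_tensor :=
  \sum_(g <- msupp (hcomp a)) \sum_(h <- msupp (hcomp b))
     ((w g h (h^-1)%g)^-1 * kG_beta h) *:
       gtens (amul (hcomp a)@_g (hcomp b)@_h) <<h>>.

Lemma hcomp_homog a g : (hcomp a)@_g \in homog A g.
Proof. by rewrite /hcomp; case: cid => f [[? ?] ?]. Qed.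

Lemma hcomp_sum a : a = \sum_(g <- msupp (hcomp a)) (hcomp a)@_g.
Proof. by rewrite /hcomp; case: cid => f [[? ?] ?]. Qed.

Lemma hcomp_sumw a (d : {fset G}) : {subset msupp (hcomp a) <= d} ->
  a = \sum_(g <- d) (hcomp a)@_g.
Proof.
move=> sd; rewrite {1}[a]hcomp_sum (big_fset_incl _ (B := d)) //.
  exact/fsubsetP.
by move=> g _ /mcoeff_outdom->.
Qed.

Lemma homog_submod g : submod_closed (homog A g).
Proof. exact: (homog_direct A).1. Qed.

Lemma homog0 g : 0 \in homog A g.
Proof. exact: (homog_submod g).1. Qed.

Lemma hcomp_uniq a (d : {fset G}) (F : G -> A) :
  (forall g, F g \in homog A g) -> (forall g, g \notin d -> F g = 0) ->
  a = \sum_(g <- d) F g -> forall g, (hcomp a)@_g = F g.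
Proof.
move=> Fh F0 aE; rewrite /hcomp; case: cid => f [[fh af] fU] /= g.
pose f' : {malg A[G]} := [malg g in d => F g].
have f'E i : f'@_i = F i.
  by rewrite mcoeffE; case: ifPn => // /F0.
rewrite (fU f') ?f'E//; split=> [i|]; first by rewrite f'E.
rewrite aE; under [RHS]eq_bigr do rewrite f'E.
symmetry; rewrite (big_fset_incl _ (B := d)) //.
  apply/fsubsetP => i; rewrite -mcoeff_neq0 f'E => Fi0.
  by apply: contraNT Fi0 => /F0->.
by move=> i _ /mcoeff_outdom; rewrite f'E.
Qed.

Lemma hcompU a g : a \in homog A g ->
  forall h, (hcomp a)@_h = a *+ (g == h).
Proof.
move=> ag; apply: (@hcomp_uniq a [fset g]%fset (fun h => a *+ (g == h))).
- by move=> h; case: eqP => [<-|_]//; rewrite homog0.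
- by move=> h; rewrite inE eq_sym => /negPf->.
- by rewrite big_seq_fset1 eqxx.
Qed.

Lemma hcompP c a b g :
  (hcomp (c *: a + b))@_g = c *: (hcomp a)@_g + (hcomp b)@_g.
Proof.
pose d := (msupp (hcomp a) `|` msupp (hcomp b))%fset.
apply: (@hcomp_uniq _ d (fun g => c *: (hcomp a)@_g + (hcomp b)@_g)).
- by move=> h; apply: (homog_submod h).2; apply: hcomp_homog.
- move=> h; rewrite inE negb_or => /andP[ha hb].
  by rewrite !mcoeff_outdom// scaler0 addr0.
- rewrite big_split -scaler_sumr /= -!hcomp_sumw// => h hh;
    by rewrite inE hh ?orbT.
Qed.

Lemma hcomp_mulr a b : b \in homog A 1%g ->
  forall g, (hcomp (amul a b))@_g = amul (hcomp a)@_g b.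
Proof.
move=> b1; apply: (@hcomp_uniq _ (msupp (hcomp a))
  (fun g => amul (hcomp a)@_g b)).
- by move=> g; rewrite -[g in homog A g]mulg1 amul_homog// hcomp_homog.
- by move=> g /mcoeff_outdom->; rewrite linear0l.
- by rewrite {1}[a]hcomp_sum linear_sumlz.
Qed.

Lemma hcomp_mull a b : b \in homog A 1%g ->
  forall g, (hcomp (amul b a))@_g = amul b (hcomp a)@_g.
Proof.
move=> b1; apply: (@hcomp_uniq _ (msupp (hcomp a))
  (fun g => amul b (hcomp a)@_g)).
- by move=> g; rewrite -[g in homog A g]mul1g amul_homog// hcomp_homog.
- by move=> g /mcoeff_outdom->; rewrite linear0.
- by rewrite {1}[a]hcomp_sum linear_sum.
Qed.

Lemma gtens0l x : gtens 0 x = 0.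
Proof. by rewrite -(scale0r 0) /gtens tensZl scale0r. Qed.

Lemma can_bilEw a b (d e : {fset G}) :
  {subset msupp (hcomp a) <= d} -> {subset msupp (hcomp b) <= e} ->
  can_bil a b = \sum_(g <- d) \sum_(h <- e)
     ((w g h (h^-1)%g)^-1 * kG_beta h) *:
       gtens (amul (hcomp a)@_g (hcomp b)@_h) <<h>>.
Proof.
move=> ad be; rewrite /can_bil (big_fset_incl _ (B := d)); first last.
- move=> g _ /mcoeff_outdom ag0; rewrite big1// => h _.
  by rewrite ag0 linear0l gtens0l scaler0.
- exact/fsubsetP.
apply: eq_bigr => g _; rewrite (big_fset_incl _ (B := e))//.
  exact/fsubsetP.
by move=> h _ /mcoeff_outdom->; rewrite linear0 gtens0l scaler0.
Qed.

Lemma can_balanced : normalized_cocycle3 w ->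
  balanced (fun (a : A) (b : coinv) => amul a (sval b))
           (fun (b : coinv) (a : A) => amul (sval b) a) can_bil.
Proof.
move=> wP; split=> [b c a a'|a c b b'|a [b b1] c] /=.
- pose d := (msupp (hcomp a) `|` msupp (hcomp a') `|`
             msupp (hcomp (c *: a + a')))%fset.
  rewrite !(@can_bilEw _ b d (msupp (hcomp b)))//;
    do ?by move=> g gd; rewrite !inE gd ?orbT.
  rewrite scaler_sumr -big_split; apply: eq_bigr => g _ /=.
  rewrite scaler_sumr -big_split; apply: eq_bigr => h _ /=.
  rewrite hcompP linearPl /gtens tensDl tensZl scalerDr !scalerA.
  by rewrite [c * _]mulrC.
- pose d := (msupp (hcomp b) `|` msupp (hcomp b') `|`
             msupp (hcomp (c *: b + b')))%fset.
  rewrite !(@can_bilEw a _ (msupp (hcomp a)) d)//;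
    do ?by move=> g gd; rewrite !inE gd ?orbT.
  rewrite scaler_sumr -big_split; apply: eq_bigr => g _ /=.
  rewrite scaler_sumr -big_split; apply: eq_bigr => h _ /=.
  rewrite hcompP linearPr /gtens tensDl tensZl scalerDr !scalerA.
  by rewrite [c * _]mulrC.
- pose d := (msupp (hcomp a) `|` msupp (hcomp (amul a b)))%fset.
  pose e := (msupp (hcomp c) `|` msupp (hcomp (amul b c)))%fset.
  rewrite (@can_bilEw (amul a b) c d e) 1?(@can_bilEw a (amul b c) d e);
    do ?by move=> g gd; rewrite !inE gd ?orbT.
  apply: eq_bigr => g _; apply: eq_bigr => h _.
  rewrite (hcomp_mulr a b1) (hcomp_mull c b1).
  rewrite (amulA (hcomp_homog a g) b1 (hcomp_homog c h)).
  by rewrite (cocycle3_normal wP) scale1r.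
Qed.

Definition can : coinv_tensor -> kG_tensor := tensor_lift can_bil.

Lemma can_linear : normalized_cocycle3 w -> linear can.
Proof. by move=> /can_balanced/tensor_liftE[]. Qed.

Lemma canE : normalized_cocycle3 w ->
  forall g h a b, a \in homog A g -> b \in homog A h ->
  can (ctens a b) =
    ((w g h (h^-1)%g)^-1 * kG_beta h) *: gtens (amul a b) <<h>>.
Proof.
move=> wP g h a b ag bh.
transitivity (can_bil a b); first exact: (tensor_liftE (can_balanced wP)).2.
rewrite (@can_bilEw a b [fset g]%fset [fset h]%fset); last 2 first.
- move=> i; rewrite -mcoeff_neq0 (hcompU ag) inE.
  by have [_|_] := eqVneq g i; rewrite ?mulr0n ?eqxx.
- move=> i; rewrite -mcoeff_neq0 (hcompU bh) inE.
  by have [_|_] := eqVneq h i; rewrite ?mulr0n ?eqxx.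
by rewrite !big_seq_fset1 (hcompU ag) (hcompU bh) !eqxx.
Qed.

Definition galois_extension : Prop := bijective can.

Definition strongly_graded : Prop :=
  forall g h : G,
    linspan [set c : A | exists a b, [/\ a \in homog A g, b \in homog A h
                                      & c = amul a b]]
    =i homog A (g * h)%g.

End Galois.

(* Main.v *)
Require Import Defs.

(* Surjectivity of can writes c (x) h, with c in A_{gh}, as the image of a    *)
(* combination of homogeneous tensors; reading off the coefficient of h and   *)
(* its component of degree gh puts c in A_g A_h.  Conversely, write           *)
(* 1 = sum_i a_i b_i with a_i in A_{h^-1} and b_i in A_h.  Up to nonzero      *)
(* scalars depending only on degrees, c (x) h |-> sum_i c a_i (x) b_i inverts *)
(* can.  Normalizing the scalars so that it is a section s of can, and noting *)
(* that s (ab (x) h) is a nonzero multiple of a (x) b because b a_i lies in   *)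
(* A_e, s is also surjective; hence can is bijective and no identity between  *)
(* the scalars is needed.                                                     *)

From HB Require Import structures.
From mathcomp Require Import all_boot all_order all_algebra.
From mathcomp Require Import finmap monalg.
From mathcomp Require Import boolp classical_sets.

Set Implicit Arguments.
Unset Strict Implicit.
Unset Printing Implicit Defensive.

Import GRing.Theory.
Local Open Scope ring_scope.

(** [can] sends A_g (x) A_h into A_{gh} (x) h, so by cancellation in G only products from A_g A_h
    can reach A_{gh} (x) h; [can_coef_hprod] makes this precise. In the other direction, a
    decomposition of 1 in A_{h^-1} A_h is inserted to the right of c in c (x) h. [can_dual_tens] and
    [dual_tens_mul] show that this undoes [can] on either side up to nonzero scalars, and
    [can_inv_surj] turns that into bijectivity. *)

Section LinearPredicate.
Variables (k : fieldType) (V W : lmodType k) (f : V -> W).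
Hypothesis f_linear : linear f.

Let F : {linear V -> W} := HB.pack f (GRing.isLinear.Build _ _ _ _ _ f_linear).

Lemma linear_map0 : f 0 = 0.
Proof. exact: (linear0 F). Qed.

Lemma linear_mapZ c v : f (c *: v) = c *: f v.
Proof. by rewrite -[f]/(F : V -> W) linearZ. Qed.

Lemma linear_map_sum (I : Type) (r : seq I) (v : I -> V) :
  f (\sum_(i <- r) v i) = \sum_(i <- r) f (v i).
Proof. exact: (linear_sum F). Qed.

End LinearPredicate.

(** * Linear maps out of direct sums, and generators of tensor products *)

Section LinearExtension.
Variables (k : fieldType) (I : choiceType) (V W : lmodType k).
Variable L : I -> V -> W.
Hypothesis L_linear : forall i, linear (L i).

(** The map out of a direct sum of copies of V induced by the family [L]; it serves both for
    homogeneous components (V = A) and for elements of kG (V = k). *)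
Definition fsum_map (x : {malg V[I]}) : W := \sum_(i <- msupp x) L i x@_i.

Lemma fsum_mapEw (d : {fset I}) x : {subset msupp x <= d} ->
  fsum_map x = \sum_(i <- d) L i x@_i.
Proof.
move=> sd; rewrite /fsum_map (big_fset_incl _ (B := d)) //.
  exact/fsubsetP.
by move=> i _ /mcoeff_outdom->; rewrite (linear_map0 (L_linear i)).
Qed.

Lemma fsum_mapP c x y z : (forall i, z@_i = c *: x@_i + y@_i) ->
  fsum_map z = c *: fsum_map x + fsum_map y.
Proof.
move=> zE; pose d := (msupp x `|` msupp y `|` msupp z)%fset.
rewrite !(@fsum_mapEw d); do ?by move=> i id; rewrite !inE id ?orbT.
rewrite scaler_sumr -big_split; apply: eq_bigr => i _ /=.
by rewrite zE L_linear.
Qed.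

Lemma fsum_mapU x i v : (forall j, x@_j = v *+ (i == j)) ->
  fsum_map x = L i v.
Proof.
move=> xE; rewrite (@fsum_mapEw [fset i]%fset) => [|j].
  by rewrite big_seq_fset1 xE eqxx.
by rewrite -mcoeff_neq0 xE inE [j == i]eq_sym; case: (i == j); rewrite ?eqxx.
Qed.

End LinearExtension.

Lemma malgU_scale (R : fieldType) (I : choiceType) (c : R) (i : I) :
  << c *g i >> = c *: (<< i >> : {malg R[I]}).
Proof. by apply/malgP => j; rewrite mcoeffZ !mcoeffU mulrnAr mulr1. Qed.

Lemma tensor_ind (k : fieldType) (M N : lmodType k) (B : Type)
    (ra : M -> B -> M) (la : B -> N -> N) (P : tensor ra la -> Prop) :
  P 0 -> (forall c t u, P t -> P u -> P (c *: t + u)) ->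
  (forall m n, P (tens ra la m n)) -> forall t, P t.
Proof.
move=> P0 PD Pg t; rewrite -[t]quotprojK (monalgE (repr t)) linear_sum /=.
elim/big_rec: _ => [//|[m n] u _ Pu].
by rewrite malgU_scale linearZ /=; apply: PD => //; apply: Pg.
Qed.

(** * Homogeneous tensors, and surjectivity of [can] implies strong grading *)

Section GradedTensors.
Variables (k : fieldType) (G : groupType) (w : G -> G -> G -> k).
Variable A : comod_algebra w.

Lemma ctens_linearl b : linear (fun a : A => ctens a b).
Proof. by move=> c a1 a2; rewrite /ctens tensDl tensZl. Qed.

Lemma ctens_linearr (a : A) : linear (ctens a).
Proof. by move=> c b1 b2; rewrite /ctens tensDr tensZr. Qed.

Lemma gtens_linearl x : linear (fun a : A => gtens a x).
Proof. by move=> c a1 a2; rewrite /gtens tensDl tensZl. Qed.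

Lemma gtens_linearr (a : A) : linear (gtens a).
Proof. by move=> c x1 x2; rewrite /gtens tensDr tensZr. Qed.

Lemma coinv_tensor_ind (P : coinv_tensor A -> Prop) :
  P 0 -> (forall c t u, P t -> P u -> P (c *: t + u)) ->
  (forall g h a b, a \in homog A g -> b \in homog A h -> P (ctens a b)) ->
  forall t, P t.
Proof.
move=> P0 PD Pg; have PA t u : P t -> P u -> P (t + u).
  by move=> Pt Pu; rewrite -[t]scale1r; apply: PD.
apply: tensor_ind => // a b; rewrite -/(ctens a b).
rewrite [a]hcomp_sum (linear_map_sum (ctens_linearl b)).
apply: big_ind => // g _.
rewrite [b]hcomp_sum (linear_map_sum (ctens_linearr _)).
by apply: big_ind => // h _; apply: Pg; exact: hcomp_homog.
Qed.

Lemma kG_tensor_ind (P : kG_tensor A -> Prop) :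
  P 0 -> (forall c t u, P t -> P u -> P (c *: t + u)) ->
  (forall g h a, a \in homog A g -> P (gtens a <<h>>)) ->
  forall t, P t.
Proof.
move=> P0 PD Pg; have PA t u : P t -> P u -> P (t + u).
  by move=> Pt Pu; rewrite -[t]scale1r; apply: PD.
apply: tensor_ind => // a x; rewrite -/(gtens a x).
rewrite [a]hcomp_sum (linear_map_sum (gtens_linearl x)).
apply: big_ind => // g _.
rewrite (monalgE x) (linear_map_sum (gtens_linearr _)).
apply: big_ind => // h _.
rewrite malgU_scale (linear_mapZ (gtens_linearr _)).
have := PD x@_h (gtens (hcomp a)@_g <<h>>) 0.
by rewrite addr0; apply=> //; apply/Pg/hcomp_homog.
Qed.

Definition kG_coef_bil (h : G) (a : A) (x : {malg k[G]}) : A := x@_h *: a.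

Lemma kG_coef_balanced h :
  balanced (fun (a : A) (c : k) => c *: a)
           (fun (c : k) (x : {malg k[G]}) => c *: x) (kG_coef_bil h).
Proof.
split=> [x c a b|a c x y|a c x]; rewrite /kG_coef_bil.
- by rewrite scalerDr !scalerA mulrC.
- by rewrite mcoeffD mcoeffZ scalerDl scalerA.
- by rewrite mcoeffZ scalerA mulrC.
Qed.

(** Identity of A tensored with the coordinate functional of h on kG. *)
Definition kG_coef (h : G) : kG_tensor A -> A := tensor_lift (kG_coef_bil h).

Lemma kG_coef_linear h : linear (kG_coef h).
Proof. exact: (tensor_liftE (kG_coef_balanced h)).1. Qed.

Lemma kG_coefE h g a : kG_coef h (gtens a <<g>>) = a *+ (g == h).
Proof.
rewrite [LHS](tensor_liftE (kG_coef_balanced h)).2 /kG_coef_bil mcoeffU.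
by case: (g == h); rewrite ?scale1r ?scale0r.
Qed.

Definition hprod (g h : G) : set A := [set c : A | exists a b,
  [/\ a \in homog A g, b \in homog A h & c = amul a b]]%classic.

Lemma hprod_homog g h : {subset linspan (hprod g h) <= homog A (g * h)%g}.
Proof.
apply: linspan_min; first exact: homog_submod.
by move=> _ [a [b [ag bh ->]]]; apply: amul_homog.
Qed.

(** By linearity t = a (x) b with degrees g', h'. The coefficient of h vanishes unless h' = h, then
    the component of degree gh vanishes unless g' = g; what survives is a multiple of ab. *)
Lemma can_coef_hprod (wP : normalized_cocycle3 w) g h (t : coinv_tensor A) :
  (hcomp (kG_coef h (can t)))@_(g * h)%g \in linspan (hprod g h).
Proof.
have hc0 i : (hcomp (0 : A))@_i = 0.
  by rewrite (hcompU (homog0 A 1%g)) mul0rn.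
have coef0 := linear_map0 (kG_coef_linear h).
elim/coinv_tensor_ind: t => [|c t u Pt Pu|g' h' a b ag bh].
- by rewrite (linear_map0 (can_linear wP)) coef0 hc0 rpred0.
- have -> : can (c *: t + u) = c *: can t + can u by exact: can_linear.
  rewrite kG_coef_linear hcompP.
  exact: (linspan_submod_closed (hprod g h)).2 c _ _ Pt Pu.
rewrite (canE wP ag bh) (linear_mapZ (kG_coef_linear h)) kG_coefE.
(* Adding 0 lets [hcompP] pull the scalar out of the component. *)
set c := (_ * _); rewrite -[c *: _]addr0 hcompP hc0 addr0 {}/c.
have [hh|_] := eqVneq h' h; last by rewrite mulr0n hc0 scaler0 rpred0.
subst h'; rewrite mulr1n (hcompU (amul_homog ag bh)).
have [/mulIg gg|_] := eqVneq (g' * h)%g (g * h)%g; last first.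
  by rewrite mulr0n scaler0 rpred0.
subst g'; rewrite mulr1n rpredZ//.
by apply: linspan_gen; exists a, b.
Qed.

Lemma can_surj_strongly_graded : normalized_cocycle3 w ->
  (forall y : kG_tensor A, exists t, can t = y) -> strongly_graded A.
Proof.
move=> wP can_surj g h c; apply/idP/idP => [|cgh]; first exact: hprod_homog.
have [t tE] := can_surj (gtens c <<h>>).
have := can_coef_hprod wP g h t.
by rewrite tE kG_coefE eqxx (hcompU cgh) eqxx.
Qed.

(** Scalars are absorbed into the left factors. *)
Lemma linspan_hprodP g h c : c \in linspan (hprod g h) ->
  exists s : seq (A * A),
    (forall p, p \in s -> p.1 \in homog A g /\ p.2 \in homog A h) /\
    c = \sum_(p <- s) amul p.1 p.2.
Proof.
move=> /asboolP[s [sS ->]]; elim: s sS => [|[x v] s IHs] sS.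
  by exists [::]; rewrite !big_nil.
have [|r [rh rE]] := IHs; first by move=> p ps; apply: sS; rewrite inE ps orbT.
have /= [a [b [ag bh vE]]] := sS _ (mem_head _ _).
exists ((x *: a, b) :: r); split=> [p|].
  rewrite inE => /orP[/eqP->|/rh//]; split=> //=.
  rewrite -[x *: a]addr0; apply: (homog_submod A g).2 => //; exact: homog0.
by rewrite !big_cons rE vE /= linearZl_LR.
Qed.

End GradedTensors.

(** * The inverse of [can] built from decompositions of 1 *)

Section Inverse.
Variables (k : fieldType) (G : groupType) (w : G -> G -> G -> k).
Variable A : comod_algebra w.
Hypothesis w_cocycle : normalized_cocycle3 w.
Variable dual : G -> seq (A * A).
Hypothesis dual_homog : forall h p, p \in dual h ->
  p.1 \in homog A h^-1%g /\ p.2 \in homog A h.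
Hypothesis dual_sum : forall h, \sum_(p <- dual h) amul p.1 p.2 = aone A.

(** For a of degree g and p in [dual h]: the first two factors come from [canE] at degrees g h^-1
    and h, the last from reassociating (a p.1) p.2. *)
Definition can_scalar (g h : G) : k :=
  (w (g * h^-1)%g h (h^-1)%g)^-1 * kG_beta w h * w g (h^-1)%g h.

Lemma can_scalar_neq0 g h : can_scalar g h != 0.
Proof. by rewrite !mulf_neq0 ?invr_eq0 ?(cocycle3_neq0 w_cocycle). Qed.

Definition dual_tens (h : G) (a : A) : coinv_tensor A :=
  \sum_(p <- dual h) ctens (amul a p.1) p.2.

Lemma dual_tens_linear h : linear (dual_tens h).
Proof.
move=> c a b; rewrite scaler_sumr -big_split; apply: eq_bigr => p _ /=.
by rewrite linearPl /ctens tensDl tensZl.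
Qed.

Lemma can_dual_tens g h a : a \in homog A g ->
  can (dual_tens h a) = can_scalar g h *: gtens a <<h>>.
Proof.
move=> ag; rewrite -[a in RHS]amul1r -(dual_sum h) (linear_sum (amul a)).
rewrite (linear_map_sum (gtens_linearl <<h>>)) scaler_sumr.
rewrite (linear_map_sum (can_linear w_cocycle)) !big_seq.
apply: eq_bigr => p /dual_homog[p1 p2].
rewrite (canE w_cocycle (amul_homog ag p1) p2) (amulA ag p1 p2).
by rewrite (linear_mapZ (gtens_linearl <<h>>)) scalerA.
Qed.

(** After reassociating (ab) p.1, the element b p.1 of A_e crosses the tensor sign; reassociating (b
    p.1) p.2 then lets the p.1 p.2 sum to 1. *)
Lemma dual_tens_mul g h a b : a \in homog A g -> b \in homog A h ->
  dual_tens h (amul a b) = (w g h h^-1%g * w h h^-1%g h) *: ctens a b.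
Proof.
move=> ag bh; rewrite -[b in RHS]amul1r -(dual_sum h) (linear_sum (amul b)).
rewrite (linear_map_sum (ctens_linearr a)) scaler_sumr /dual_tens !big_seq.
apply: eq_bigr => p /dual_homog[p1 p2].
have bp1 : amul b p.1 \in homog A 1%g by rewrite -(mulgV h) amul_homog.
rewrite (amulA ag bh p1) (linear_mapZ (ctens_linearl p.2)) -scalerA.
congr (_ *: _).
have -> : ctens (amul a (amul b p.1)) p.2 = ctens a (amul (amul b p.1) p.2).
  exact: (tens_bal _ _ a (exist _ (amul b p.1) bp1 : coinv A) p.2).
by rewrite (amulA bh p1 p2) (linear_mapZ (ctens_linearr a)).
Qed.

(** The normalizing scalar depends on the degree g, so the inverse is defined one homogeneous
    component at a time. *)
Definition can_inv_summand (h g : G) (a : A) : coinv_tensor A :=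
  (can_scalar g h)^-1 *: dual_tens h a.

Lemma can_inv_summand_linear h g : linear (can_inv_summand h g).
Proof.
move=> c a b; rewrite /can_inv_summand dual_tens_linear scalerDr !scalerA.
by rewrite [c * _]mulrC.
Qed.

Definition can_inv_at (h : G) (a : A) : coinv_tensor A :=
  fsum_map (can_inv_summand h) (hcomp a).

Lemma can_inv_at_linear h : linear (can_inv_at h).
Proof.
move=> c a b; apply: fsum_mapP; first exact: can_inv_summand_linear.
by move=> g; rewrite hcompP.
Qed.

Lemma can_inv_atE g h a : a \in homog A g ->
  can_inv_at h a = (can_scalar g h)^-1 *: dual_tens h a.
Proof.
move=> ag; rewrite /can_inv_at.
by rewrite (fsum_mapU (can_inv_summand_linear h) (hcompU ag)).
Qed.

Definition can_inv_bil (a : A) (x : {malg k[G]}) : coinv_tensor A :=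
  @fsum_map k G k^o _ (fun h c => c *: can_inv_at h a) x.

Lemma can_inv_bil_linear_coef a h :
  linear (fun c : k^o => c *: can_inv_at h a).
Proof. by move=> c x y; rewrite scalerDl scalerA. Qed.

Lemma can_inv_balanced :
  balanced (fun (a : A) (c : k) => c *: a)
           (fun (c : k) (x : {malg k[G]}) => c *: x) can_inv_bil.
Proof.
have linl x : linear (can_inv_bil^~ x).
  move=> c a b; rewrite /can_inv_bil /fsum_map scaler_sumr -big_split.
  apply: eq_bigr => h _ /=; rewrite can_inv_at_linear scalerDr !scalerA.
  by rewrite [c * _]mulrC.
have linr a : linear (can_inv_bil a).
  move=> c x y; apply: (fsum_mapP (can_inv_bil_linear_coef a)) => h.
  by rewrite mcoeffD mcoeffZ.
split; [exact: linl|exact: linr|move=> a c x].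
by rewrite (linear_mapZ (linl x)) (linear_mapZ (linr a)).
Qed.

Definition can_inv : kG_tensor A -> coinv_tensor A := tensor_lift can_inv_bil.

Lemma can_inv_linear : linear can_inv.
Proof. exact: (tensor_liftE can_inv_balanced).1. Qed.

Lemma can_invE g h a : a \in homog A g ->
  can_inv (gtens a <<h>>) = (can_scalar g h)^-1 *: dual_tens h a.
Proof.
move=> ag; rewrite -(can_inv_atE h ag).
rewrite [LHS](tensor_liftE can_inv_balanced).2 /can_inv_bil.
rewrite (fsum_mapU (can_inv_bil_linear_coef a) (i := h) (v := 1)) ?scale1r//.
by move=> j; rewrite mcoeffU.
Qed.

Lemma can_invK : cancel can_inv (@can _ _ _ A).
Proof.
have canL := can_linear w_cocycle (A := A); have invL := can_inv_linear.
elim/kG_tensor_ind => [|c t u tE uE|g h a ag].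
- by rewrite (linear_map0 invL) (linear_map0 canL).
- have -> : can_inv (c *: t + u) = c *: can_inv t + can_inv u by exact: invL.
  have -> : can (c *: can_inv t + can_inv u) =
    c *: can (can_inv t) + can (can_inv u) by exact: canL.
  by congr (c *: _ + _).
rewrite (can_invE h ag) (linear_mapZ canL) (can_dual_tens h ag) scalerA.
by rewrite mulVf ?scale1r ?can_scalar_neq0.
Qed.

(** A surjective section is a two-sided inverse, so with [can_invK] this replaces a comparison of
    the scalars of [can] with those of [can_inv]. *)
Lemma can_inv_surj t : exists y, can_inv y = t.
Proof.
have invL := can_inv_linear.
elim/coinv_tensor_ind: t => [|c _ _ [y <-] [z <-]|g h a b ag bh].
- by exists 0; rewrite (linear_map0 invL).
- by exists (c *: y + z); exact: invL.
(* [can_inv] maps ab (x) h to c times a (x) b. *)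
pose c := (can_scalar (g * h)%g h)^-1 * (w g h h^-1%g * w h h^-1%g h).
have c_neq0 : c != 0.
  by rewrite !mulf_neq0 ?invr_eq0 ?can_scalar_neq0 ?(cocycle3_neq0 w_cocycle).
exists (c^-1 *: gtens (amul a b) <<h>>).
rewrite (linear_mapZ invL) (can_invE h (amul_homog ag bh)).
rewrite (dual_tens_mul ag bh) [X in _ *: X]scalerA -/c scalerA.
by rewrite mulVf// scale1r.
Qed.

Lemma can_bijective : galois_extension A.
Proof.
exists can_inv; last exact: can_invK.
by move=> t; have [y <-] := can_inv_surj t; rewrite can_invK.
Qed.

End Inverse.

Theorem proposition11 (k : fieldType) (G : groupType) (w : G -> G -> G -> k)
    (w_cocycle : normalized_cocycle3 w) (A : comod_algebra w) :
  galois_extension A <-> strongly_graded A.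
Proof.
split=> [[can' _ can'K]|Astrong].
  by apply: can_surj_strongly_graded => // y; exists (can' y).
(* 1 lies in A_e = A_{h^-1} A_h; the sigma type chooses a decomposition for every h. *)
have dualP h : {s : seq (A * A) |
    (forall p, p \in s -> p.1 \in homog A h^-1%g /\ p.2 \in homog A h) /\
    aone A = \sum_(p <- s) amul p.1 p.2}.
  apply/cid/linspan_hprodP; rewrite Astrong mulVg; exact: aone_homog.
apply: (@can_bijective _ _ _ A w_cocycle (fun h => sval (dualP h))) => h.
  exact: (svalP (dualP h)).1.
by rewrite -(svalP (dualP h)).2.
Qed.
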